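(* Let $G$ be a simple connected graph with $N_0$ vertices and $E_0\ge1$ edges, and let $n\ge1$. The Kemeny's constant of the $n$-th hexagonal graph $H_n(G)$ satisfies $$K(H_n(G))=5K(H_{n-1}(G))-\frac43N_0+\left(\frac{104}{15}6^{n-1}+\frac{16}{15}\right)E_0-2,$$ and in general $$K(H_n(G))=5^nK(G)-\frac13(5^n-1)N_0+\frac{104}{3}\left[\left(\frac65\right)^n-1\right]\cdot5^{n-1}E_0+\frac4{15}(5^n-1)E_0-\frac12(5^n-1).$$
   Context: Graphs are finite, simple and connected. The hexagonal graph $H(G)$ of $G$ is obtained by replacing each edge $uv$ of $G$ by two internally disjoint $u$–$v$ paths, one of length $1$ (the edge $uv$ itself) and one of length $5$ (with 4 new internal vertices). Set $H_0(G)=G$ and $H_n(G)=H(H_{n-1}(G))$ for $n\ge1$. The normalized Laplacian of a graph with adjacency matrix $A$ and diagonal degree matrix $D$ is $\mathcal{L}=I-D^{-1/2}AD^{-1/2}$. For a connected graph $F$ with $N$ vertices and normalized Laplacian eigenvalues $0=\lambda_1<\lambda_2\le\cdots\le\lambda_N$ (with multiplicity), the Kemeny's constant is $K(F)=\sum_{i=2}^{N}\frac1{\lambda_i}$. *)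

(* Defs.v *)
From HB Require Import structures.
From mathcomp Require Import all_boot all_order all_algebra.
From mathcomp Require Import polyorder polyrcf.

Set Implicit Arguments.
Unset Strict Implicit.
Unset Printing Implicit Defensive.

Import Order.TTheory GRing.Theory Num.Theory.
Local Open Scope ring_scope.

Record sgraph := SGraph {
  vertex : finType;
  adj : rel vertex;
  adj_sym : symmetric adj;
  adj_irr : irreflexive adj }.

Definition connected_graph (G : sgraph) : Prop :=
  (0 < #|vertex G|)%N /\ forall x y : vertex G, connect (@adj G) x y.

Definition nb_vertices (G : sgraph) : nat := #|vertex G|.

Definition edges (G : sgraph) : {set {set vertex G}} :=
  [set [set p.1; p.2] | p : vertex G * vertex G & adj p.1 p.2].

Definition nb_edges (G : sgraph) : nat := #|edges G|.

(* A dart is an edge with one of its two orientations.  To avoid choosing an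
   orientation of each edge, the four internal vertices of the path of length 5
   added alongside an edge uv are indexed by the darts (u, v) and (v, u), two
   for each dart:
     u -- ((u,v),false) -- ((u,v),true) -- ((v,u),true) -- ((v,u),false) -- v *)
Definition dart (G : sgraph) : finType :=
  {p : vertex G * vertex G | adj p.1 p.2}.

Definition hex_vertex (G : sgraph) : finType :=
  (vertex G + dart G * bool)%type.

Definition hex_adj (G : sgraph) : rel (hex_vertex G) := fun x y =>
  match x, y with
  | inl u, inl v => adj u v
  | inl u, inr (d, b) | inr (d, b), inl u => ~~ b && ((val d).1 == u)
  | inr (d, b), inr (d', b') =>
      ((d == d') && (b != b')) ||
      [&& b, b', (val d).1 == (val d').2 & (val d).2 == (val d').1]
  end.

Lemma hex_adj_sym (G : sgraph) : symmetric (@hex_adj G).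
Proof.
move=> [u|[d b]] [v|[d' b']] //=; first exact: adj_sym.
rewrite (eq_sym d') (eq_sym b') andbCA (eq_sym (val d').1) (eq_sym (val d').2).
by rewrite [((val d).2 == _) && _]andbC.
Qed.

Lemma hex_adj_irr (G : sgraph) : irreflexive (@hex_adj G).
Proof.
move=> [u|[d b]] /=; first exact: adj_irr.
rewrite !eqxx andbF /=; apply/negP => /and4P[_ _ /eqP d12 _].
by have := valP d; rewrite /= d12 adj_irr.
Qed.

Definition hexagonal (G : sgraph) : sgraph :=
  SGraph (@hex_adj_sym G) (@hex_adj_irr G).

Definition hexagonal_iter (n : nat) (G : sgraph) : sgraph :=
  iter n hexagonal G.

Section Kemeny.

Variable R : rcfType.

Definition degree (G : sgraph) (u : vertex G) : nat := #|[set v | adj u v]|.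

Definition adjacency_mx (G : sgraph) : 'M[R]_#|vertex G| :=
  \matrix_(i, j) (adj (enum_val i) (enum_val j))%:R.

Definition inv_sqrt_degree_mx (G : sgraph) : 'M[R]_#|vertex G| :=
  diag_mx (\row_i (Num.sqrt (degree (enum_val i))%:R)^-1).

Definition normalized_laplacian (G : sgraph) : 'M[R]_#|vertex G| :=
  1%:M - inv_sqrt_degree_mx G *m adjacency_mx G *m inv_sqrt_degree_mx G.

(* [rootsR] is strictly increasing, so this lists the eigenvalues lying in R in
   nondecreasing order, with algebraic multiplicity.  A symmetric matrix over a
   real closed field has all its eigenvalues in that field. *)
Definition spectrum (n : nat) (A : 'M[R]_n) : seq R :=
  flatten [seq nseq (\mu_x (char_poly A)) x | x <- rootsR (char_poly A)].

Definition kemeny (G : sgraph) : R :=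
  \sum_(x <- behead (spectrum (normalized_laplacian G))) x^-1.

End Kemeny.

(* Main.v *)
Require Import Defs.
From mathcomp Require Import all_boot all_order all_algebra.
From mathcomp Require Import perm spectral complex polyorder polyrcf.
From mathcomp Require Import zify ring lra.

Set Implicit Arguments.
Unset Strict Implicit.
Unset Printing Implicit Defensive.

Import Order.TTheory GRing.Theory Num.Theory.
Local Open Scope ring_scope.

(** Everything follows from the one-step formula ([kemeny_hex])

      K(H(G)) = 5 K(G) - 4/3 N + 8 E - 2,

    because H(G) has N + 4E vertices and 6E edges and is again connected: this
    gives the sizes of the iterates, and the closed formula is the solution of
    the resulting linear recurrence.

    For the one-step formula, let D and A be the degree and adjacency matrices.
    The eigenvalues of the normalized Laplacian are the zeros of
    x -> det ((1 - x) D - A).  For H(G), whose new vertices lie on paths with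
    four internal vertices, this determinant is computed by eliminating the new
    vertices: with t = 2 (1 - x) and w = t^4 - 3 t^2 + 1, the Schur complement is

      (t - (t^3 - 2 t) / w) D - (1 + 1 / w) A

    in the matrices D and A of G ([det_hex_pencil]), and the eliminated block has
    determinant w^E.  The latter is established only up to sign, so squares are
    compared; nothing is lost, since only logarithmic derivatives matter in the
    end.  Consequently the squares of the two products

      w^N prod_m (m - x)   and
      w^E (t^2 - 1)^N prod_l (- 2 x (t^2 + t - 1) + (t^2 - 2) l)

    agree up to a nonzero constant, where m and l run through the eigenvalues of
    H(G) and G ([hex_spectral_identity]).

    For a connected graph 0 is a simple eigenvalue and the others are positive
    ([spectrum_laplacian]), so both sides have exactly one factor x to cancel.
    The Kemeny constant is then minus the logarithmic derivative at 0 of the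
    product of the remaining factors m - x, and comparing the logarithmic
    derivatives of the two sides at x = 0 gives the one-step formula. *)

(** * Spectra of real symmetric matrices *)

Lemma char_poly_conj (F : fieldType) n (P A : 'M[F]_n) :
  P \in unitmx -> char_poly (invmx P *m A *m P) = char_poly A.
Proof.
move=> Pu; rewrite /char_poly.
have -> : char_poly_mx (invmx P *m A *m P) =
    map_mx polyC (invmx P) *m char_poly_mx A *m map_mx polyC P.
  rewrite /char_poly_mx mulmxBr mulmxBl !map_mxM; congr (_ - _).
  by rewrite scalar_mxC -mulmxA -map_mxM mulVmx // map_mx1 mulmx1.
rewrite !det_mulmx mulrC mulrA -det_mulmx -map_mxM mulmxV //.
by rewrite map_mx1 det1 mul1r.
Qed.

(** The row space is spanned by the unit vectors at the nonzero entries.  For a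
    diagonalizable matrix this bounds the algebraic multiplicity of the
    eigenvalue 0 by the dimension of the kernel. *)
Lemma mxrank_diag_le (F : fieldType) n (d : 'rV[F]_n) :
  (\rank (diag_mx d) + #|[pred i | d 0%R i == 0%R]| <= n)%N.
Proof.
have sub : (diag_mx d <= \sum_(i | d 0 i != 0) delta_mx i i)%MS.
  apply/row_subP => i; rewrite row_diag_mx.
  have [->|di] := eqVneq (d 0 i) 0; first by rewrite scale0r sub0mx.
  apply/scalemx_sub/(submx_trans _ (sumsmx_sup i di (submx_refl _))).
  by rewrite -(mul_delta_mx i) submxMl.
have le : (\rank (\sum_(i | d 0%R i != 0%R) delta_mx i i : 'M[F]_n)%MS
    <= \sum_(i | d 0%R i != 0%R) 1)%N.
  apply: (big_ind2 (fun (A : 'M[F]_n) r => (\rank A <= r)%N)).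
  - by rewrite mxrank0.
  - by move=> A r B s Ar Bs; apply/(leq_trans (mxrank_adds_leqif A B))/leq_add.
  - by move=> i _; rewrite mxrank_delta.
have := leq_trans (mxrankS sub) le; rewrite sum1_card => {le} le.
rewrite -[leqRHS]card_ord -(cardC [pred i | d 0%R i == 0%R]) addnC leq_add2l.
by rewrite (leq_trans le) //; apply/subset_leq_card/subsetP => i; rewrite !inE.
Qed.

(** The spectral theorem is applied over the complexification of [R], where the
    eigenvalues of the Hermitian matrix [A] are real; the factorization of the
    characteristic polynomial and the rank both descend to [R]. *)
Lemma sym_real_diag (R : rcfType) n (A : 'M[R]_n) : A^T = A ->
  exists d : 'rV[R]_n, char_poly A = \prod_i ('X - (d 0 i)%:P) /\
    (\rank A + #|[pred i | d 0%R i == 0%R]| <= n)%N.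
Proof.
move=> Asym; pose f := real_complex R; pose B := map_mx f A.
have Bherm : B \is hermsymmx.
  apply: realsym_hermsym.
    apply/is_hermitianmxP; rewrite expr0 scale1r.
    by apply/matrixP => i j; rewrite !mxE /= -[in LHS]Asym mxE.
  by apply/mxOverP => i j; rewrite mxE; apply/complex_realP; exists (A i j).
pose P := spectralmx B; pose sp := spectral_diag B.
have Pu : P \in unitmx := spectral_unit B.
have eqB : B = invmx P *m diag_mx sp *m P.
  exact/orthomx_spectralP/hermitian_normalmx.
have spR i : f (complex.Re (sp 0 i)) = sp 0 i.
  by apply/RRe_real; have /mxOverP := hermitian_spectral_diag_real Bherm; apply.
pose d := \row_i complex.Re (sp 0 i).
have spE : sp = map_mx f d by apply/rowP => i; rewrite !mxE spR.
exists d; split.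
  apply: (map_poly_inj f); rewrite map_char_poly /= -/B eqB char_poly_conj //.
  rewrite char_poly_trig ?diag_mx_is_trig // rmorph_prod; apply: eq_bigr => i _.
  by rewrite /= mxE eqxx mulr1n map_polyXsubC spE mxE.
suff -> : \rank A = \rank (diag_mx d) by exact: mxrank_diag_le.
rewrite -(mxrank_map f A) -/B eqB mxrankMfree ?row_free_unit //.
rewrite eqmxMfull ?row_full_unit ?unitmx_inv //.
by rewrite spE -map_diag_mx mxrank_map.
Qed.

Lemma mu_prod_linear (R : rcfType) (x : R) (s : seq R) :
  \mu_x (\prod_(y <- s) ('X - y%:P)) = count_mem x s.
Proof.
elim: s => [|y s IH]; first by rewrite big_nil muNroot // root1.
rewrite big_cons mu_mul; last first.
  by rewrite mulf_neq0 ?polyXsubC_eq0 // monic_neq0 ?monic_prod_XsubC.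
rewrite IH /=; congr (_ + _)%N.
have [->|yx] := eqVneq y x; first by rewrite mu_XsubC.
by rewrite muNroot // root_XsubC eq_sym.
Qed.

Lemma mem_rootsR (R : rcfType) (p : {poly R}) x :
  p != 0 -> (x \in rootsR p) = root p x.
Proof. by move=> /roots_on_rootsR/(_ x) <-; rewrite itv_boundlr /=. Qed.

Lemma spectrum_perm (R : rcfType) n (A : 'M[R]_n) (s : seq R) :
  char_poly A = \prod_(x <- s) ('X - x%:P) -> perm_eq (spectrum A) s.
Proof.
move=> pE; rewrite /spectrum; set p := char_poly A in pE *.
have p0 : p != 0 by rewrite pE monic_neq0 ?monic_prod_XsubC.
apply/allP => y _ /=; apply/eqP.
have roots_p : (y \in rootsR p) = (y \in s).
  by rewrite mem_rootsR // pE root_prod_XsubC.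
rewrite count_flatten -map_comp sumnE big_map.
under eq_bigr => x _ do rewrite /= count_nseq.
have [ys|ys] := boolP (y \in s); last first.
  rewrite big1_seq; first by rewrite (count_memPn ys).
  move=> x /andP[_]; rewrite -roots_p in ys => xr /=; case: (x =P y) => [xy|_].
    by rewrite xy (negPf ys) in xr.
  by rewrite mul0n.
rewrite (big_rem y) ?roots_p //= eqxx mul1n big1_seq ?addn0.
  by rewrite pE mu_prod_linear.
move=> x /andP[_]; rewrite mem_rem_uniq ?uniq_roots // inE => /andP[/negPf /= -> _].
by rewrite mul0n.
Qed.

(** [kemeny] drops the first listed eigenvalue.  The list is sorted, so this
    first entry is 0 once all eigenvalues are nonnegative, and the rest of the
    list is unaffected by 0 because 0 is simple. *)
Lemma spectrum_simple0 (R : rcfType) n (A : 'M[R]_n) (s : seq R) :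
  char_poly A = \prod_(x <- s) ('X - x%:P) ->
  {in s, forall x, 0 <= x} -> count_mem 0 s = 1%N ->
  spectrum A = 0 :: behead (spectrum A).
Proof.
move=> pE s_ge0 s0; rewrite /spectrum; set p := char_poly A in pE *.
have p0 : p != 0 by rewrite pE monic_neq0 ?monic_prod_XsubC.
have roots_p y : (y \in rootsR p) = (y \in s).
  by rewrite mem_rootsR // pE root_prod_XsubC.
have mem0 : 0 \in s by rewrite -has_pred1 has_count s0.
have := sorted_roots (- cauchy_bound p) (cauchy_bound p) p.
rewrite -/(rootsR p).
case E : (rootsR p) => [|x r] /= xr; first by rewrite -roots_p E in mem0.
suff -> : x = 0 by rewrite pE mu_prod_linear s0.
have x_ge0 : 0 <= x by rewrite s_ge0 // -roots_p E mem_head.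
have := mem0; rewrite -roots_p E inE => /predU1P[//|r0].
have := order_path_min lt_trans xr => /allP/(_ _ r0) /= x_lt0.
by have := le_lt_trans x_ge0 x_lt0; rewrite ltxx.
Qed.

Lemma sum_enum_val (V : nmodType) (T : finType) (F : T -> V) :
  \sum_(i < #|T|) F (enum_val i) = \sum_x F x.
Proof. by rewrite -(big_enum_val F). Qed.

(** * The normalized Laplacian of a connected graph *)

Section Laplacian.

Variables (R : rcfType) (G : sgraph).
Hypothesis deg_gt0 : forall u : vertex G, (0 < degree u)%N.

Local Notation N := #|vertex G|.
Local Notation L := (normalized_laplacian R G).
Local Notation vx i := (enum_val (i : 'I_N)).
Local Notation a i j := ((adj (vx i) (vx j))%:R : R).
Local Notation deg i := ((degree (vx i))%:R : R).
Local Notation s i := ((Num.sqrt (deg i))^-1 : R).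

Lemma laplacianE (i j : 'I_N) : L i j = (i == j)%:R - s i * a i j * s j.
Proof. by rewrite /normalized_laplacian mul_diag_mx mul_mx_diag !mxE. Qed.

Lemma adj_row_sum (i : 'I_N) : \sum_j a i j = deg i.
Proof.
rewrite (sum_enum_val (fun x => (adj (vx i) x)%:R)) -natr_sum; congr _%:R.
rewrite /degree -sum1_card [RHS]big_mkcond.
by apply: eq_bigr => x _; rewrite inE; case: ifP.
Qed.

Lemma sqrt_deg_neq0 (i : 'I_N) : Num.sqrt (deg i) != 0.
Proof. by rewrite sqrtr_eq0 -ltNge ltr0n. Qed.

Lemma sqr_inv_sqrt_deg (i : 'I_N) : s i ^+ 2 * deg i = 1.
Proof. by rewrite exprVn sqr_sqrtr ?ler0n // mulVf // pnatr_eq0 -lt0n. Qed.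

Lemma laplacian_sym : L^T = L.
Proof.
apply/matrixP => i j.
by rewrite mxE !laplacianE (eq_sym j) (adj_sym (vx j)); ring.
Qed.

(** The Dirichlet form: each edge is counted in both directions, whence the
    factor 2. *)
Lemma laplacian_form (v : 'rV[R]_N) :
  (v *m L *m v^T) 0 0 *+ 2 =
  \sum_i \sum_j a i j * (v 0 i * s i - v 0 j * s j) ^+ 2.
Proof.
have diag : \sum_i \sum_j a i j * (v 0 i * s i) ^+ 2 = \sum_i v 0 i ^+ 2.
  apply: eq_bigr => i _; rewrite -mulr_suml adj_row_sum exprMn mulrCA.
  by rewrite (mulrC (deg i)) sqr_inv_sqrt_deg mulr1.
have diag' : \sum_i \sum_j a i j * (v 0 j * s j) ^+ 2 = \sum_i v 0 i ^+ 2.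
  rewrite -diag exchange_big; apply: eq_bigr => i _; apply: eq_bigr => j _.
  by rewrite adj_sym.
pose c i j := a i j * (v 0 i * s i * (v 0 j * s j)).
have -> : (v *m L *m v^T) 0 0 = \sum_i v 0 i ^+ 2 - \sum_i \sum_j c i j.
  rewrite mxE [X in _ - X]exchange_big -sumrB; apply: eq_bigr => j _.
  have -> : (v *m L) 0 j = v 0 j - \sum_i v 0 i * (s i * a i j * s j).
    rewrite mxE; under eq_bigr => i _ do rewrite laplacianE mulrBr.
    rewrite sumrB (bigD1 j) //= eqxx mulr1 big1 ?addr0 // => i /negPf ->.
    by rewrite mulr0.
  rewrite mulrBl mxE expr2; congr (_ - _); rewrite mulr_suml.
  by apply: eq_bigr => i _; rewrite /c; ring.
rewrite mulrnBl mulr2n -{1}diag -diag' -big_split.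
rewrite -sumrMnl -sumrB; apply: eq_bigr => i _ /=.
rewrite -big_split -sumrMnl -sumrB; apply: eq_bigr => j _ /=.
by rewrite /c; ring.
Qed.

Lemma laplacian_eigenvalue_ge0 (x : R) : eigenvalue L x -> 0 <= x.
Proof.
case/eigenvalueP => v vL v0; have := laplacian_form v.
rewrite vL -scalemxAl mxE -mulrnAr => form.
have vv : 0 < (v *m v^T) 0 0.
  rewrite mxE lt_def sumr_ge0 ?andbT => [|i _]; last by rewrite mxE -expr2 sqr_ge0.
  apply: contraNneq v0 => /eqP; rewrite psumr_eq0 => [/allP vv0|i _]; last first.
    by rewrite mxE -expr2 sqr_ge0.
  apply/eqP/rowP => i; have /= := vv0 i (mem_index_enum _).
  by rewrite !mxE -expr2 sqrf_eq0 => /eqP.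
rewrite -(pmulr_lge0 x (x := (v *m v^T) 0 0 *+ 2)) ?pmulrn_lgt0 // form.
by apply: sumr_ge0 => i _; apply: sumr_ge0 => j _; rewrite mulr_ge0 ?sqr_ge0.
Qed.

Hypothesis Gconn : connected_graph G.

Let w : 'rV[R]_N := \row_i Num.sqrt (deg i).

(** If [v] is in the kernel then its Dirichlet form vanishes, so [v i] divided
    by the square root of the degree is constant along edges, hence everywhere
    by connectedness. *)
Lemma laplacian_kernel : (kermx L :=: w)%MS.
Proof.
apply/eqmxP/andP; split.
  apply/rV_subP => v /sub_kermxP vL; have := laplacian_form v.
  rewrite vL mul0mx mxE mul0rn => /esym/eqP.
  have ge0 i j : 0 <= a i j * (v 0 i * s i - v 0 j * s j) ^+ 2.
    by rewrite mulr_ge0 ?sqr_ge0.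
  rewrite psumr_eq0 => [/allP q0|i _]; last by apply: sumr_ge0 => j _.
  have edge i j : adj (vx i) (vx j) -> v 0 i * s i = v 0 j * s j.
    move=> aij; have /= := q0 i (mem_index_enum _).
    rewrite psumr_eq0 => [/allP /(_ j (mem_index_enum _)) /=|? _]; last exact: ge0.
    by rewrite aij mul1r sqrf_eq0 subr_eq0 => /eqP.
  pose g x := v 0 (enum_rank x) * s (enum_rank x).
  have g_edge x y : adj x y -> g x = g y.
    by move=> xy; apply: edge; rewrite !enum_rankK.
  have g_const x y : g x = g y.
    case/connectP: (Gconn.2 x y) => p + ->; elim: p x => //= z p IH x.
    by case/andP => /g_edge -> /IH.
  have [x0 _] : exists x : vertex G, x \in vertex G by apply/card_gt0P/Gconn.1.
  have -> : v = g x0 *: w; last by rewrite scalemx_sub.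
  apply/rowP => i; rewrite !mxE (g_const x0 (vx i)) /g enum_valK.
  by rewrite divfK ?sqrt_deg_neq0.
apply/sub_kermxP/rowP => j; rewrite !mxE.
under eq_bigr => i _ do rewrite laplacianE mulrBr !mxE.
rewrite sumrB (bigD1 j) //= eqxx mulr1 big1 ?addr0 => [|i /negPf ->]; last first.
  by rewrite mulr0.
have -> : \sum_i Num.sqrt (deg i) * (s i * a i j * s j) = s j * \sum_i a j i.
  rewrite mulr_sumr; apply: eq_bigr => i _.
  by rewrite adj_sym !mulrA divff ?sqrt_deg_neq0 // mul1r mulrC.
rewrite adj_row_sum -[X in _ * X](sqr_sqrtr (ler0n R (degree (vx j)))).
by rewrite expr2 mulKf ?sqrt_deg_neq0 // subrr.
Qed.

(** Positive semidefiniteness comes from the Dirichlet form; the simplicity of 0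
    from the one-dimensional kernel, since algebraic and geometric
    multiplicities of a symmetric matrix agree. *)
Lemma spectrum_laplacian : exists2 s : seq R,
  spectrum L = 0 :: s &
  [/\ char_poly L = \prod_(x <- 0 :: s) ('X - x%:P), all (> 0) s & size s = N.-1].
Proof.
have [d [pE rk]] := sym_real_diag laplacian_sym.
pose t := [seq d 0 i | i <- enum 'I_N].
have pE' : char_poly L = \prod_(x <- t) ('X - x%:P).
  by rewrite pE /t big_map big_enum.
have t_eig x : (x \in t) = eigenvalue L x.
  by rewrite eigenvalue_root_char pE' root_prod_XsubC.
have t_ge0 : {in t, forall x, 0 <= x}.
  by move=> x; rewrite t_eig; apply: laplacian_eigenvalue_ge0.
have w0 : w != 0.
  have [x _] : exists x : vertex G, x \in vertex G by apply/card_gt0P/Gconn.1.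
  apply/eqP => /rowP/(_ (enum_rank x))/eqP; rewrite !mxE.
  by rewrite (negPf (sqrt_deg_neq0 _)).
have rkL : (\rank L).+1 = N.
  have := mxrank_ker L; rewrite laplacian_kernel rank_rV w0 => /esym.
  by case: N (\rank L) (rank_leq_row L) => [|n] m; lia.
have t0 : count_mem 0 t = 1%N.
  apply/eqP; rewrite eqn_leq; apply/andP; split.
    rewrite count_map -sum1_count big_mkcond big_enum -big_mkcond sum1_card.
    by rewrite -(leq_add2l (\rank L)) addn1 rkL; exact: rk.
  rewrite -has_count has_pred1 t_eig; apply/eigenvalueP; exists w => //.
  by rewrite scale0r; apply/sub_kermxP; rewrite laplacian_kernel.
have perm := spectrum_perm pE'; have sp0 := spectrum_simple0 pE' t_ge0 t0.
exists (behead (spectrum L)) => //; rewrite -sp0; split.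
- by rewrite pE'; apply: perm_big; rewrite perm_sym.
- apply/allP => x xs; rewrite lt_def t_ge0 ?andbT; last first.
    by rewrite -(perm_mem perm) sp0 inE xs orbT.
  apply: contraTneq xs => ->; rewrite -has_pred1 has_count -leqNgt.
  by have /seq.permP/(_ (pred1 0)) := perm; rewrite t0 sp0 /= eqxx add1n => -[->].
- by rewrite size_behead (perm_size perm) size_map size_enum_ord.
Qed.

End Laplacian.

(** * Auxiliary determinants and products *)

(** A bijection between the index types acts on rows and columns by the same
    permutation, so its sign occurs twice. *)
Lemma det_reindex (R : comPzRingType) (T : Type) n m (f : 'I_n -> T)
    (g : 'I_m -> T) (M : T -> T -> R) : bijective f -> bijective g ->
  \det (\matrix_(i, j) M (f i) (f j)) = \det (\matrix_(i, j) M (g i) (g j)).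
Proof.
move=> bf [g' gK g'K]; have bij : bijective (g' \o f).
  by apply: bij_comp bf; exists g.
have nm : n = m by rewrite -(card_ord n) -(card_ord m) (bij_eq_card bij).
case: m / nm g g' gK g'K bij => g g' gK g'K bij.
pose p := perm (bij_inj bij).
have -> : \matrix_(i, j) M (f i) (f j) =
    row_perm p (col_perm p (\matrix_(i, j) M (g i) (g j))).
  by apply/matrixP => i j; rewrite !mxE !permE /= !g'K.
rewrite row_permE col_permE !det_mulmx !det_perm odd_permV.
by rewrite mulrCA mulrA -mulrA -signr_addb addbb mulr1.
Qed.

Lemma prodrMl_seq (R : comPzRingType) (T : Type) (s : seq T) (c : R)
    (f : T -> R) :
  \prod_(x <- s) (c * f x) = c ^+ size s * \prod_(x <- s) f x.
Proof.
elim: s => [|x s IH]; first by rewrite !big_nil mulr1.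
by rewrite !big_cons IH exprS mulrACA.
Qed.

Lemma det_add_scale (F : fieldType) n (A : 'M[F]_n) (s : seq F) (a b : F) :
  char_poly A = \prod_(x <- s) ('X - x%:P) -> b != 0 ->
  \det (a%:M + b *: A) = \prod_(x <- s) (a + b * x).
Proof.
move=> pE b0; pose c := - a / b.
have size_s : size s = n.
  by have := size_char_poly A; rewrite pE size_prod_XsubC => -[].
have -> : a%:M + b *: A = (- b) *: (c%:M - A).
  rewrite scalerBr scale_scalar_mx scaleNr opprK; congr (_%:M + _).
  by rewrite /c; field.
rewrite detZ.
have -> : \det (c%:M - A) = (char_poly A).[c].
  rewrite -horner_evalE -det_map_mx; congr (\det _).
  apply/matrixP => i j; rewrite !mxE /= /horner_eval.
  by rewrite hornerD hornerN hornerC hornerMn hornerX.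
rewrite pE horner_prod -size_s -prodrMl_seq.
by apply: eq_bigr => x _; rewrite hornerXsubC /c; field.
Qed.

(** * Darts and the combinatorics of the hexagonal graph *)

Section Darts.

Variable G : sgraph.

Lemma dart_sum (V : nmodType) (F : vertex G -> vertex G -> V) :
  \sum_(d : dart G) F (val d).1 (val d).2 = \sum_x \sum_(y | adj x y) F x y.
Proof.
rewrite pair_big_dep /=; apply/esym.
exact: (big_sub (fun p : vertex G * vertex G => adj p.1 p.2)
  (fun p => F p.1 p.2)).
Qed.

Fact rev_dart_subproof (d : dart G) :
  adj ((val d).2, (val d).1).1 ((val d).2, (val d).1).2.
Proof. by rewrite adj_sym (valP d). Qed.

Definition rev_dart (d : dart G) : dart G :=
  exist _ ((val d).2, (val d).1) (rev_dart_subproof d).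

Lemma rev_dartK : involutive rev_dart.
Proof. by move=> d; apply: val_inj; rewrite /=; case: (val d). Qed.

Lemma rev_dart_eq (d d' : dart G) :
  (d' == rev_dart d) = ((val d).1 == (val d').2) && ((val d).2 == (val d').1).
Proof.
rewrite -val_eqE /=; case: (val d) (val d') => [u v] [u' v'] /=.
by rewrite xpair_eqE andbC (eq_sym u) (eq_sym v).
Qed.

Lemma card_darts_degree : #|dart G| = (\sum_(x : vertex G) degree x)%N.
Proof.
rewrite -sum1_card (dart_sum (fun _ _ => 1%N)); apply: eq_bigr => x _.
by rewrite sum1_card /degree cardsE.
Qed.

(** The fibre of the map from darts to edges over the edge of a dart consists of
    that dart and its reversal. *)
Lemma card_darts : #|dart G| = (nb_edges G).*2.
Proof.
rewrite -sum1_card (partition_big (fun d : dart G => [set (val d).1; (val d).2])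
  (fun e => e \in edges G)) /=; last first.
  by move=> d _; apply/imsetP; exists (val d); rewrite ?inE ?(valP d).
rewrite -muln2 -sum_nat_const; apply: eq_bigr => e /imsetP [p].
rewrite inE => pe ->.
pose d : dart G := exist _ p (pe : adj p.1 p.2).
rewrite sum1_card (eq_card (B := pred2 d (rev_dart d))).
  rewrite card2; suff -> : d != rev_dart d by [].
  rewrite rev_dart_eq /= andbC; apply/negP => /andP[/eqP E _].
  by have := pe; rewrite E adj_irr.
move=> d'; suff: ([set (val d').1; (val d').2] == [set p.1; p.2]) =
  (d' == d) || (d' == rev_dart d) by [].
apply/eqP/orP; last first.
  by case=> /eqP -> //=; rewrite setUC.
move=> E; have := set21 (val d').1 (val d').2.
have := set22 (val d').1 (val d').2.
rewrite E !in_set2 -(inj_eq val_inj) rev_dart_eq /=.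
have : adj (sval d').1 (sval d').2 by exact: (valP d').
rewrite /=; move: (sval d') => [u v] /= uv /orP[]/eqP vE /orP[]/eqP uE;
  rewrite {}uE {}vE ?adj_irr //= in uv *.
- by right; rewrite !eqxx.
- by left; case: (p).
Qed.

End Darts.

Section HexCombinatorics.

Variable G : sgraph.

Local Notation H := (hexagonal G).

Lemma card_dart_fst (u : vertex G) :
  #|[set d : dart G | (val d).1 == u]| = degree u.
Proof.
rewrite -sum1_card big_mkcond.
under eq_bigr => d _ do rewrite inE.
rewrite (dart_sum (fun x _ => if x == u then 1%N else 0%N)) (bigD1 u) //= eqxx.
rewrite sum1_card big1 ?addr0 => [|x /negPf ->]; last by rewrite big1.
by apply: eq_card => x; rewrite inE.
Qed.

Lemma degree_hex_old (u : vertex G) : @degree H (inl u) = (degree u).*2.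
Proof.
have -> : @degree H (inl u) =
    #|inl @: [set v | adj u v] :|:
      (fun d => inr (d, false)) @: [set d : dart G | (val d).1 == u]|.
  apply: eq_card => -[v|[d b]]; rewrite !inE.
    rewrite mem_imset ?inE; last by move=> ? ? [].
    by case: imsetP => [[? _]|]; rewrite ?orbF.
  have -> : (inr (d, b) \in inl @: [set v | adj u v]) = false.
    by apply/imsetP => -[].
  rewrite /=; apply/andP/imsetP => [[nb ud]|[d' + [-> ->]]].
    by exists d; rewrite ?inE //; case: b nb.
  by rewrite inE.
rewrite cardsU (_ : _ :&: _ = set0) ?cards0 ?subn0; last first.
  apply/setP => x; rewrite !inE; apply/negP => /andP[/imsetP[v _ ->]].
  by case/imsetP.
rewrite !card_imset; last 2 first.
- by move=> ? ? [].
- by move=> ? ? [].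
by rewrite card_dart_fst -addnn.
Qed.

Lemma degree_hex_new (d : dart G) b : @degree H (inr (d, b)) = 2.
Proof.
case: b; last first.
  have -> : @degree H (inr (d, false)) =
      #|[set inl (val d).1; inr (d, true) : vertex H]|.
    apply: eq_card => -[v|[d' b']]; rewrite !inE /=.
      by apply/eqP/orP => [->|[/eqP[]|/eqP]] //; left.
    by rewrite orbF; apply/andP/eqP => [[/eqP <-]|[-> ->]] //; case: b'.
  by rewrite cards2.
have -> : @degree H (inr (d, true)) =
    #|[set inr (d, false); inr (rev_dart d, true) : vertex H]|.
  apply: eq_card => -[v|[d' b']]; rewrite !inE //= -rev_dart_eq.
  apply/orP/orP => [[/andP[/eqP <-]|/andP[b1 /eqP ->]]|[/eqP[-> ->]|/eqP[-> ->]]].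
  - by case: b' => // _; left.
  - by right; rewrite b1.
  - by left; rewrite eqxx.
  - by right; rewrite eqxx.
rewrite cards2; case: eqP => // -[].
Qed.

Lemma nb_vertices_hex : nb_vertices H = (nb_vertices G + 4 * nb_edges G)%N.
Proof.
rewrite /nb_vertices card_sum card_prod card_bool card_darts; lia.
Qed.

(** Handshake count: the degrees of the old vertices double and each of the
    four new vertices per edge has degree 2, so that twice the number of edges
    grows from 2E to 4E + 8E. *)
Lemma nb_edges_hex : nb_edges H = (6 * nb_edges G)%N.
Proof.
apply: double_inj; rewrite -card_darts card_darts_degree big_sumType /=.
under eq_bigr => u _ do rewrite degree_hex_old -muln2.
rewrite -big_distrl -card_darts_degree /=.
rewrite (eq_bigr (fun=> 2)) => [|[d b] _]; last exact: degree_hex_new.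
rewrite sum_nat_const card_prod card_bool card_darts; lia.
Qed.

Lemma connected_hex : connected_graph G -> connected_graph H.
Proof.
case=> G0 Gc; split; first by rewrite card_sum addn_gt0 G0.
have sym := sym_connect_sym (@hex_adj_sym G).
have old u v : connect (@hex_adj G) (inl u) (inl v).
  case/connectP: (Gc u v) => p + ->; elim: p u => //= w p IH u /andP[uw wp].
  exact: connect_trans (connect1 (uw : hex_adj (inl u) (inl w))) (IH w wp).
have new d b : connect (@hex_adj G) (inl (val d).1) (inr (d, b)).
  have c1 : connect (@hex_adj G) (inl (val d).1) (inr (d, false)).
    by apply: connect1; rewrite /= eqxx.
  case: b => //; apply: connect_trans c1 (connect1 _).
  by rewrite /= eqxx.
have from x u : connect (@hex_adj G) (inl u) x.
  by case: x => [v|[d b]]; [exact: old | exact: connect_trans (old _ _) (new d b)].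
have [u _] : exists u : vertex G, u \in vertex G by apply/card_gt0P.
by move=> x y; apply: (connect_trans (y := inl u)); rewrite // sym.
Qed.

End HexCombinatorics.

Lemma degree_gt0 (G : sgraph) : connected_graph G -> (1 <= nb_edges G)%N ->
  forall u : vertex G, (0 < degree u)%N.
Proof.
move=> [_ Gc] /card_gt0P[e /imsetP[[x y]]]; rewrite inE /= => xy _ u.
have [->|ux] := eqVneq u x; first by apply/card_gt0P; exists y; rewrite inE.
case/connectP: (Gc u x) => -[|v p] /=; first by move=> _ xu; rewrite xu eqxx in ux.
by case/andP => uv _ _; apply/card_gt0P; exists v; rewrite inE.
Qed.

(** * The determinant of the pencil of the hexagonal graph *)

Definition degree_mx (R : rcfType) (G : sgraph) : 'M[R]_#|vertex G| :=
  diag_mx (\row_i (degree (enum_val i))%:R).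

Section Pencil.

Variables (R : rcfType) (G : sgraph).

Local Notation H := (hexagonal G).
Local Notation nV := #|vertex G|.
Local Notation nD := #|dart G|.
Local Notation A := (adjacency_mx R G).
Local Notation Dg := (degree_mx R G).

(** Incidence of the old vertices with the new vertices [(d, false)], each of
    which is adjacent to the origin of the dart [d]. *)
Definition tail_mx : 'M[R]_(nV, nD) :=
  \matrix_(i, d) ((val (enum_val d)).1 == enum_val i)%:R.

(** Adjacency between the new vertices [(d, true)], the middle edges of the
    added paths. *)
Definition rev_mx : 'M[R]_nD :=
  \matrix_(d, e) (enum_val e == rev_dart (enum_val d))%:R.

Local Notation B := tail_mx.
Local Notation J := rev_mx.

Lemma tail_mxM_tr : B *m B^T = Dg.
Proof.
apply/matrixP => i j; rewrite !mxE.
under eq_bigr => d _ do rewrite !mxE.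
rewrite (sum_enum_val (fun d : dart G =>
  ((val d).1 == enum_val i)%:R * ((val d).1 == enum_val j)%:R)).
rewrite (dart_sum (fun x _ => (x == enum_val i)%:R * (x == enum_val j)%:R)).
rewrite (bigD1 (enum_val i)) //= [X in _ + X]big1 ?addr0 => [|x /negPf xi].
  rewrite sumr_const eqxx mul1r (inj_eq enum_val_inj) -mulrnA mulnC mulrnA.
  by congr (_%:R *+ _); rewrite /degree cardsE.
by rewrite big1 // => y _; rewrite xi mul0r.
Qed.

Lemma tail_rev_mxE : B *m J = \matrix_(i, d) ((val (enum_val d)).2 == enum_val i)%:R.
Proof.
apply/matrixP => i e; rewrite !mxE.
under eq_bigr => d _ do rewrite !mxE.
rewrite (sum_enum_val (fun d : dart G =>
  ((val d).1 == enum_val i)%:R * (enum_val e == rev_dart d)%:R)).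
rewrite (bigD1 (rev_dart (enum_val e))) //= rev_dartK eqxx mulr1.
rewrite big1 ?addr0 // => d; rewrite -(inj_eq (inv_inj (@rev_dartK G))) rev_dartK.
by rewrite eq_sym => /negPf ->; rewrite mulr0.
Qed.

Lemma tail_rev_tailM : B *m J *m B^T = A.
Proof.
apply/matrixP => i j; rewrite tail_rev_mxE !mxE.
under eq_bigr => d _ do rewrite !mxE.
rewrite (sum_enum_val (fun d : dart G =>
  ((val d).2 == enum_val i)%:R * ((val d).1 == enum_val j)%:R)).
rewrite (dart_sum (fun x y => (y == enum_val i)%:R * (x == enum_val j)%:R)).
rewrite (bigD1 (enum_val j)) //= [X in _ + X]big1 ?addr0 => [|x /negPf xi]; last first.
  by rewrite big1 // => y _; rewrite xi mulr0.
rewrite big_mkcond (bigD1 (enum_val i)) //= big1 => [|y /negPf yi].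
  by rewrite !eqxx mulr1 addr0 adj_sym; case: ifP.
by rewrite yi mul0r if_same.
Qed.

Lemma rev_mxK : J *m J = 1%:M.
Proof.
apply/matrixP => i e; rewrite !mxE.
under eq_bigr => d _ do rewrite !mxE.
rewrite (sum_enum_val (fun d : dart G =>
  (d == rev_dart (enum_val i))%:R * (enum_val e == rev_dart d)%:R)).
rewrite (bigD1 (rev_dart (enum_val i))) //= rev_dartK eqxx mul1r.
rewrite (inj_eq enum_val_inj) eq_sym.
by rewrite big1 ?addr0 // => d /negPf ->; rewrite mul0r.
Qed.

(** An orientation of every edge, chosen through the enumeration of vertices:
    the two darts of an edge get opposite signs. *)
Definition orientation_sign (d : dart G) : R :=
  (-1) ^+ (enum_rank (val d).1 < enum_rank (val d).2)%N.

Lemma orientation_sign_rev d : orientation_sign (rev_dart d) = - orientation_sign d.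
Proof.
rewrite /orientation_sign /=; case: ltngtP => //= [_|/ord_inj/enum_rank_inj E].
- by rewrite opprK.
- by have := valP d; rewrite /= E adj_irr.
Qed.

(** Conjugation by the diagonal of orientation signs turns [J] into [- J], so
    [a - b J] and [a + b J] have equal determinants, while their product is
    scalar because [J] is an involution.  This determines the determinant up to
    sign, which is why all later identities are between squares. *)
Lemma det_rev_pencil (a b : R) :
  \det (a%:M - b *: J) ^+ 2 = (a ^+ 2 - b ^+ 2) ^+ nD.
Proof.
pose S : 'M[R]_nD := diag_mx (\row_d orientation_sign (enum_val d)).
have SS : S *m S = 1%:M.
  rewrite mulmx_diag; apply/matrixP => i j; rewrite !mxE.
  by rewrite -expr2 sqrr_sign.
have SJS : S *m J *m S = - J.
  rewrite mul_diag_mx mul_mx_diag; apply/matrixP => i j; rewrite !mxE.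
  have [->|] := eqVneq (enum_val j) (rev_dart (enum_val i)); last first.
    by rewrite mulr0 mul0r oppr0.
  by rewrite orientation_sign_rev mulr1 mulrN -expr2 sqrr_sign.
have dS : \det S ^+ 2 = 1 by rewrite expr2 -det_mulmx SS det1.
have -> : \det (a%:M - b *: J) ^+ 2 =
    \det ((a%:M - b *: J) *m (S *m (a%:M - b *: J) *m S)).
  by rewrite !det_mulmx -[LHS]mulr1 -dS; ring.
have -> : S *m (a%:M - b *: J) *m S = a%:M + b *: J.
  rewrite mulmxBr mulmxBl mul_mx_scalar -scalemxAl SS scalemx1.
  by rewrite -scalemxAr -scalemxAl SJS scalerN opprK.
rewrite mulmxDr mul_mx_scalar mulmxBl mul_scalar_mx -scalemxAl -scalemxAr rev_mxK.
rewrite -det_scalar; congr (\det _).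
by apply/matrixP => i j; rewrite !mxE; case: (i == j); rewrite ?mulr1n ?mulr0n; ring.
Qed.

(** Enumerates the old vertices first, then the vertices [(d, false)], then the
    vertices [(d, true)], to expose the block structure. *)
Definition hex_index (i : 'I_(nV + (nD + nD))) : vertex H :=
  match split i with
  | inl u => inl (enum_val u)
  | inr k => match split k with
             | inl d => inr (enum_val d, false)
             | inr d => inr (enum_val d, true)
             end
  end.

Lemma hex_index_bij : bijective hex_index.
Proof.
apply: inj_card_bij; last by rewrite card_ord card_sum card_prod card_bool; lia.
move=> i j; rewrite /hex_index.
case: (split_ordP i) => u ->; case: (split_ordP j) => v -> //.
- by case=> /enum_val_inj ->.
- by case: split_ordP.
- by case: split_ordP.
by case: (split_ordP u) => d ->; case: (split_ordP v) => e -> // [] /enum_val_inj ->.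
Qed.

Lemma hex_pencil_block (y : R) :
  \matrix_(i, j) (y * ((degree (hex_index i))%:R *+ (i == j))
                   - (adj (hex_index i) (hex_index j))%:R) =
  block_mx ((y * 2) *: Dg - A) (row_mx (- B) 0) (col_mx (- B^T) 0)
    (block_mx (y * 2)%:M (- 1%:M) (- 1%:M) ((y * 2)%:M - J)).
Proof.
have eL u : hex_index (lshift _ u) = inl (enum_val u).
  by rewrite /hex_index (unsplitK (inl u)).
have eF d : hex_index (rshift _ (lshift _ d)) = inr (enum_val d, false).
  by rewrite /hex_index (unsplitK (inr _)) (unsplitK (inl _)).
have eT d : hex_index (rshift _ (rshift _ d)) = inr (enum_val d, true).
  by rewrite /hex_index (unsplitK (inr _)) (unsplitK (inr _)).
apply/matrixP => i j; rewrite mxE.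
case: (split_ordP i) => [u ->|i' ->]; [|case: (split_ordP i') => d -> {i'}];
  (case: (split_ordP j) => [v ->|j' ->]; [|case: (split_ordP j') => e -> {j'}]);
  rewrite ?(block_mxEul, block_mxEur, block_mxEdl, block_mxEdr, row_mxEl, row_mxEr,
    col_mxEu, col_mxEd) ?eL ?eF ?eT !mxE /=
    ?(degree_hex_old, degree_hex_new)
    ?(inj_eq (@lshift_inj _ _), inj_eq (@rshift_inj _ _),
     eq_lrshift, eq_rlshift) ?mulr0n ?mulr0 ?sub0r ?oppr0 ?eqxx.
- by rewrite -muln2 natrM; case: (u == v); rewrite ?mulr1n ?mulr0n; ring.
- by [].
- by [].
- by [].
- by rewrite andbF orbF subr0 mulrnAr.
- by rewrite andbT orbF (inj_eq enum_val_inj).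
- by [].
- by rewrite andbT orbF (inj_eq enum_val_inj).
- by rewrite andbF mulrnAr rev_dart_eq.
Qed.

(** One elimination step reduces the adjacency pencil of the disjoint paths with
    four vertices to [(t^2 - 1) - t J].  The value
    (t^2 - 1)^2 - t^2 = t^4 - 3 t^2 + 1 is the Chebyshev polynomial U_4 at t / 2. *)
Lemma det_path_block (t : R) : t != 0 ->
  \det (block_mx t%:M (- 1%:M) (- 1%:M) (t%:M - J)) ^+ 2 =
  ((t ^+ 2 - 1) ^+ 2 - t ^+ 2) ^+ nD.
Proof.
move=> t0; set M := block_mx _ _ _ _.
have ME : M *m block_mx 1%:M t^-1%:M 0 1%:M =
    block_mx t%:M 0 (- 1%:M) (t^-1 *: ((t ^+ 2 - 1)%:M - t *: J)).
  rewrite /M mulmx_block !mulmx1 !mulmx0 !addr0 mul_mx_scalar mulNmx mul1mx.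
  rewrite scale_scalar_mx mulVf // subrr; congr block_mx.
  apply/matrixP => i j; rewrite !mxE; case: (i == j); rewrite ?mulr1n ?mulr0n; by field.
have := congr1 (fun X => \det X ^+ 2) ME.
rewrite det_mulmx det_ublock !det1 !mulr1 => ->.
rewrite det_lblock det_scalar detZ mulrA -exprMn divff // expr1n mul1r.
exact: det_rev_pencil.
Qed.

(** Schur complement with respect to the new vertices.  The corner blocks of the
    inverse of the path pencil only involve 1 and [J], and [B B^T] and
    [B J B^T] are the degree and adjacency matrices of [G], so that the
    complement is again a combination of these two matrices. *)
Lemma det_hex_pencil (t : R) (w := (t ^+ 2 - 1) ^+ 2 - t ^+ 2) : t != 0 -> w != 0 ->
  \det ((t / 2) *: degree_mx R H - adjacency_mx R H) ^+ 2 =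
  w ^+ nD * \det ((t - (t ^+ 3 - 2 * t) / w) *: Dg - (1 + w^-1) *: A) ^+ 2.
Proof.
move=> t0 w0.
have -> : \det ((t / 2) *: degree_mx R H - adjacency_mx R H) =
    \det (\matrix_(i, j) (t / 2 * ((degree (hex_index i))%:R *+ (i == j))
                   - (adj (hex_index i) (hex_index j))%:R)).
  pose F x y := t / 2 * ((@degree H x)%:R *+ (x == y)) - (@adj H x y)%:R.
  transitivity (\det (\matrix_(i, j) F (hex_index i) (hex_index j))); last first.
    congr (\det _); apply/matrixP => i j; rewrite !mxE /F.
    by rewrite (inj_eq (bij_inj hex_index_bij)).
  rewrite -(det_reindex F (@enum_val_bij (vertex H)) hex_index_bij).
  by congr (\det _); apply/matrixP => i j; rewrite !mxE /F (inj_eq enum_val_inj).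
rewrite hex_pencil_block divfK ?pnatr_eq0 //.
pose X2 := w^-1 *: ((t ^+ 2 - 1) *: B^T + t *: (J *m B^T)).
pose X1 := w^-1 *: ((t ^+ 3 - 2 * t) *: B^T + J *m B^T).
set M := block_mx t%:M _ _ _; set X := block_mx _ _ _ _.
(* [X1] and [X2] solve t X1 - X2 = B^T and (t - J) X2 = X1, so that adding the
   corresponding columns clears the lower left block of [X]. *)
have XE : X *m block_mx 1%:M 0 (col_mx X1 X2) 1%:M =
    block_mx ((t - (t ^+ 3 - 2 * t) / w) *: Dg - (1 + w^-1) *: A) (row_mx (- B) 0) 0 M.
  rewrite /X mulmx_block !mulmx1 !mulmx0 !add0r mul_row_col mul0mx addr0 mulNmx.
  congr block_mx.
    rewrite /X1 -scalemxAr mulmxDr -scalemxAr mulmxA tail_mxM_tr tail_rev_tailM.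
    by apply/matrixP => i j; rewrite !mxE; ring.
  rewrite /M mul_block_col mul_scalar_mx !mulNmx !mul1mx add_col_mx.
  rewrite -[0 in RHS]col_mx0; congr col_mx.
    apply/matrixP => i j; rewrite !mxE.
    by move: w0; rewrite /w => w0; field.
  rewrite mulmxBl mul_scalar_mx -!scalemxAr mulmxDr -!scalemxAr mulmxA rev_mxK mul1mx.
  by apply/matrixP => i j; rewrite !mxE; ring.
have := congr1 (fun Y => \det Y ^+ 2) XE.
rewrite det_mulmx det_lblock !det1 !mulr1 => ->.
by rewrite det_ublock exprMn det_path_block // mulrC.
Qed.

End Pencil.

(** * From determinants to eigenvalues *)

(** With [T] the diagonal of square roots of degrees, the combination of degree
    and adjacency matrices is [T ((a - b) + b L) T]. *)
Lemma det_pencil (R : rcfType) (G : sgraph) (s : seq R) (a b : R) :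
  (forall u : vertex G, 0 < degree u)%N ->
  char_poly (normalized_laplacian R G) = \prod_(x <- s) ('X - x%:P) -> b != 0 ->
  \det (a *: degree_mx R G - b *: adjacency_mx R G) =
  \det (degree_mx R G) * \prod_(x <- s) (a - b + b * x).
Proof.
move=> deg_gt0 pE b0; rewrite -(det_add_scale _ pE b0).
pose T : 'M[R]_#|vertex G| := diag_mx (\row_i Num.sqrt (degree (enum_val i))%:R).
have TT : T *m T = degree_mx R G.
  rewrite mulmx_diag; congr diag_mx; apply/rowP => i; rewrite !mxE.
  by rewrite -expr2 sqr_sqrtr ?ler0n.
have -> : a *: degree_mx R G - b *: adjacency_mx R G =
    T *m ((a - b)%:M + b *: normalized_laplacian R G) *m T.
  move: (normalized_laplacian R G) (@laplacianE R G) => L LE.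
  rewrite -TT mulmx_diag mul_diag_mx mul_mx_diag.
  apply/matrixP => i j; rewrite !mxE LE.
  have := sqrt_deg_neq0 R deg_gt0 i; have := sqrt_deg_neq0 R deg_gt0 j.
  case: (eqVneq i j) => [<-|_] d1 d2; rewrite ?mulr1n ?mulr0n; field;
    by rewrite ?d1 ?d2.
by rewrite !det_mulmx -TT det_mulmx mulrAC.
Qed.

Lemma det_degree_mx_neq0 (R : rcfType) (G : sgraph) :
  (forall u : vertex G, 0 < degree u)%N -> \det (degree_mx R G) != 0.
Proof.
move=> deg_gt0; rewrite det_diag; apply/prodf_neq0 => i _.
by rewrite mxE pnatr_eq0 -lt0n.
Qed.

Lemma poly_eq_generic (F : numFieldType) (p q r : {poly F}) : r != 0 ->
  (forall x, r.[x] != 0 -> p.[x] = q.[x]) -> p = q.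
Proof.
move=> r0 pq; apply/eqP; rewrite -subr_eq0 -(mulrI_eq0 _ (mulfI r0)).
apply: contraT => z0; set z := r * (p - q) in z0.
pose t : seq F := [seq k%:R | k <- iota 0 (size z)].
have /(max_poly_roots z0) : all (root z) t.
  apply/allP => x _; rewrite /root /z hornerM hornerD hornerN.
  by have [->|/pq ->] := eqVneq r.[x] 0; rewrite ?mul0r ?subrr ?mulr0.
rewrite size_map size_iota ltnn => -> //.
by rewrite map_inj_uniq ?iota_uniq // => i j /eqP; rewrite eqr_nat => /eqP.
Qed.

(** [a] is the logarithmic derivative of [p] at 0.  The relational form carries
    the nonvanishing of [p] at 0 along with the value, and avoids division. *)
Definition has_logderiv0 (F : fieldType) (p : {poly F}) (a : F) : Prop :=
  p.[0] != 0 /\ p^`().[0] = a * p.[0].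

Section LogDerivative.

Variable F : fieldType.
Implicit Types (p q : {poly F}) (a b c : F).

Lemma has_logderiv0_unique p a b : has_logderiv0 p a -> has_logderiv0 p b -> a = b.
Proof. by move=> [p0 pa] [_]; rewrite pa => /(mulIf p0). Qed.

Lemma has_logderiv0M p q a b :
  has_logderiv0 p a -> has_logderiv0 q b -> has_logderiv0 (p * q) (a + b).
Proof.
move=> [p0 pa] [q0 qb]; split; first by rewrite hornerM mulf_neq0.
by rewrite derivM hornerD !hornerM pa qb; ring.
Qed.

Lemma has_logderiv0C c : c != 0 -> has_logderiv0 c%:P 0.
Proof. by move=> c0; split; rewrite ?derivC ?hornerC // mul0r. Qed.

Lemma has_logderiv0X p a n : has_logderiv0 p a -> has_logderiv0 (p ^+ n) (n%:R * a).
Proof.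
move=> pa; elim: n => [|n IH].
  by rewrite expr0 mul0r; apply: (has_logderiv0C (oner_neq0 _)).
by rewrite exprS -add1n natrD mulrDl mul1r; apply: has_logderiv0M.
Qed.

Lemma has_logderiv0_prod (T : eqType) (s : seq T) (f : T -> {poly F}) (g : T -> F) :
  {in s, forall x, has_logderiv0 (f x) (g x)} ->
  has_logderiv0 (\prod_(x <- s) f x) (\sum_(x <- s) g x).
Proof.
elim: s => [|x s IH] fg.
  by rewrite !big_nil; apply: (has_logderiv0C (oner_neq0 _)).
rewrite !big_cons; apply: has_logderiv0M; first exact: fg (mem_head _ _).
by apply: IH => y ys; apply: fg; rewrite inE ys orbT.
Qed.

End LogDerivative.

(** * One step of the hexagonal construction *)

Section OneStep.

Variables (R : rcfType) (G : sgraph).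
Hypotheses (Gconn : connected_graph G) (E_gt0 : (1 <= nb_edges G)%N).

Local Notation H := (hexagonal G).

(** The Schur complement at t = 2 (1 - x) has the shape a D - b A.  Multiplying
    the factor a - b + b l by w makes it polynomial: it becomes
    (t^2 - 1) ((t^3 - t^2 - 3 t + 2) + (t^2 - 2) l), and the constant term
    factors as (t - 2) (t^2 + t - 1) = - 2 x (t^2 + t - 1). *)
Lemma hex_spectral_identity (sG sH : seq R) (x : R) :
  char_poly (normalized_laplacian R G) = \prod_(l <- sG) ('X - l%:P) ->
  char_poly (normalized_laplacian R H) = \prod_(m <- sH) ('X - m%:P) ->
  size sG = #|vertex G| ->
  let t := 2 - 2 * x in let w := (t ^+ 2 - 1) ^+ 2 - t ^+ 2 in
  t != 0 -> w != 0 -> w + 1 != 0 ->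
  w ^+ #|vertex G| ^+ 2 * (\det (degree_mx R H) ^+ 2 * (\prod_(m <- sH) (m - x)) ^+ 2) =
  w ^+ #|dart G| * (\det (degree_mx R G) ^+ 2 * ((t ^+ 2 - 1) ^+ #|vertex G| ^+ 2 *
    (\prod_(l <- sG) (- 2 * x * (t ^+ 2 + t - 1) + (t ^+ 2 - 2) * l)) ^+ 2)).
Proof.
move=> pG pH sz t w t0 w0 w1.
have dG := degree_gt0 Gconn E_gt0.
have dH : forall u : vertex H, (0 < degree u)%N.
  by apply: degree_gt0; [exact: connected_hex | rewrite nb_edges_hex; lia].
have := det_hex_pencil G t0 w0; rewrite -/w.
rewrite -[adjacency_mx R H]scale1r (det_pencil _ dH pH (oner_neq0 _)).
have b0 : 1 + w^-1 != 0.
  by rewrite -(mulfV w0) -[X in _ + X]mul1r -mulrDl mulf_neq0 ?invr_eq0.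
rewrite (det_pencil _ dG pG b0).
set cG := \det (degree_mx R G); set cH := \det (degree_mx R H).
have -> : \prod_(m <- sH) (t / 2 - 1 + 1 * m) = \prod_(m <- sH) (m - x).
  by apply: eq_bigr => m _; rewrite /t; field.
move=> E; rewrite -exprMn {}E.
set q := \prod_(l <- sG) _; set q' := \prod_(l <- sG) _.
have qE : w ^+ #|vertex G| * q = (t ^+ 2 - 1) ^+ #|vertex G| * q'.
  rewrite -sz -!prodrMl_seq; apply: eq_bigr => l _.
  have -> : x = 1 - t / 2 by rewrite /t; field.
  move: w0; rewrite /w; move: (t) => u u0; by field.
transitivity (w ^+ #|dart G| * (cG ^+ 2 * (w ^+ #|vertex G| * q) ^+ 2)).
  by ring.
by rewrite qE exprMn.
Qed.

(** In the spectral identity the eigenvalue 0 contributes the factor [x] (up to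
    sign) for the hexagonal graph and 2 x (t^2 + t - 1) for [G].  After the
    square of [x] is cancelled, the logarithmic derivatives at x = 0, that is
    t = 2, are compared. *)
Lemma kemeny_hex :
  kemeny R H = 5 * kemeny R G - 4 / 3 * (nb_vertices G)%:R
               + 8 * (nb_edges G)%:R - 2.
Proof.
have dG := degree_gt0 Gconn E_gt0.
have Hconn := connected_hex Gconn.
have dH : forall u : vertex H, (0 < degree u)%N.
  by apply: degree_gt0 => //; rewrite nb_edges_hex; lia.
rewrite /kemeny.
have [sG -> [pG sG0 szG]] := spectrum_laplacian R dG Gconn.
have [sH -> [pH sH0 _]] := spectrum_laplacian R dH Hconn.
rewrite /=.
have N0 := Gconn.1.
set N := #|vertex G| in szG N0; set nD := #|dart G|.
(* [T] and [W] are kept abstract so that evaluation rewriting stops at them. *)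
have [T TE] : {T : {poly R} | T = 2%:P - 2%:P * 'X}.
  by exists (2%:P - 2%:P * 'X).
have [W WE] : {W : {poly R} | W = (T ^+ 2 - 1) ^+ 2 - T ^+ 2}.
  by exists ((T ^+ 2 - 1) ^+ 2 - T ^+ 2).
(* Up to T^2 - 1, the factor of the eigenvalue [l] of [G] multiplied by [W]. *)
pose g (l : R) : {poly R} :=
  - 2%:P * 'X * (T ^+ 2 + T - 1) + (T ^+ 2 - 2%:P) * l%:P.
pose cG := \det (degree_mx R G); pose cH := \det (degree_mx R H).
have evT x : T.[x] = 2 - 2 * x by rewrite TE !hornerE.
have evW x : W.[x] = ((2 - 2 * x) ^+ 2 - 1) ^+ 2 - (2 - 2 * x) ^+ 2.
  by rewrite WE !(hornerE, horner_exp) evT.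
have ident : W ^+ N ^+ 2 * ((cH ^+ 2)%:P * (\prod_(m <- sH) (m%:P - 'X)) ^+ 2) =
    W ^+ nD * ((4 * cG ^+ 2)%:P * ((T ^+ 2 - 1) ^+ N ^+ 2 * ((T ^+ 2 + T - 1) ^+ 2 *
      (\prod_(l <- sG) g l) ^+ 2))).
  apply: (@poly_eq_generic _ _ _ ('X * T * W * (W + 1))) => [|x].
    (* This product is nonzero as a polynomial since its value at 2 is -120. *)
    apply: contraTneq isT => /(congr1 (fun p => p.[2])).
    rewrite !hornerM hornerD evW evT hornerX !hornerC.
    rewrite (_ : _ * _ = - 120%:R); last by ring.
    by move/eqP; rewrite oppr_eq0 pnatr_eq0.
  rewrite !(hornerE, horner_exp, evW, evT, horner_prod).
  rewrite !mulf_eq0 !negb_or => /andP[/andP[/andP[x0 t0] w0] w1].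
  have := hex_spectral_identity pG pH _ t0 w0 w1.
  rewrite !big_cons /= szG prednK // => /(_ erefl) E.
  (* Both sides of [E] contain x^2, from the eigenvalue 0 of either graph. *)
  apply: (mulfI (expf_neq0 2 x0)).
  set PH := \prod_(m <- sH) _ in E; set PG := \prod_(l <- sG) _ in E.
  have -> : \prod_(m <- sH) (m%:P - 'X).[x] = PH.
    by apply: eq_bigr => m _; rewrite !hornerE.
  have -> : \prod_(l <- sG) (g l).[x] = PG.
    by apply: eq_bigr => l _; rewrite /g !(hornerE, horner_exp, evT); ring.
  apply: etrans (etrans E _); first by rewrite -/cH; ring.
  by rewrite -/cG; ring.
have T0 : T.[0] = 2 by rewrite evT; ring.
have W0 : W.[0] = 5 by rewrite evW; ring.
have dT : T^`() = (- 2)%:P.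
  by rewrite TE derivB derivC derivM derivC derivX mul0r mulr1 !add0r polyCN.
have ldW : has_logderiv0 W (-8).
  split; first by rewrite W0 pnatr_eq0.
  by rewrite W0 WE !derivE dT !(hornerE, horner_exp) T0; ring.
have ldT1 : has_logderiv0 (T ^+ 2 - 1) (- (8 / 3)).
  have v : (T ^+ 2 - 1).[0] = 3 by rewrite !(hornerE, horner_exp) T0; ring.
  split; first by rewrite v pnatr_eq0.
  by rewrite v !derivE dT !(hornerE, horner_exp) T0; field.
have ldT2 : has_logderiv0 (T ^+ 2 + T - 1) (-2).
  have v : (T ^+ 2 + T - 1).[0] = 5 by rewrite !(hornerE, horner_exp) T0; ring.
  split; first by rewrite v pnatr_eq0.
  by rewrite v !derivE dT !(hornerE, horner_exp) T0; ring.
have ldg : {in sG, forall l, has_logderiv0 (g l) (-5 * l^-1 - 4)}.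
  move=> l /(allP sG0)/lt0r_neq0 l0.
  have v : (g l).[0] = 2 * l by rewrite !(hornerE, horner_exp) T0; ring.
  split; first by rewrite v mulf_neq0 ?pnatr_eq0.
  by rewrite v /g !derivE dT !(hornerE, horner_exp) T0 /=; field.
have ldm : {in sH, forall m, has_logderiv0 (m%:P - 'X) (- m^-1)}.
  move=> m /(allP sH0)/lt0r_neq0 m0.
  split; first by rewrite !hornerE subr0.
  by rewrite !derivE !(hornerE, horner_exp); field.
have cG0 : 4 * cG ^+ 2 != 0.
  by rewrite mulf_neq0 ?pnatr_eq0 ?expf_neq0 ?det_degree_mx_neq0.
have cH0 : cH ^+ 2 != 0 by rewrite expf_neq0 ?det_degree_mx_neq0.
have := has_logderiv0M (has_logderiv0X 2 (has_logderiv0X N ldW))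
  (has_logderiv0M (has_logderiv0C cH0) (has_logderiv0X 2 (has_logderiv0_prod ldm))).
rewrite ident => /has_logderiv0_unique/(_ (has_logderiv0M (has_logderiv0X nD ldW)
  (has_logderiv0M (has_logderiv0C cG0)
  (has_logderiv0M (has_logderiv0X 2 (has_logderiv0X N ldT1))
  (has_logderiv0M (has_logderiv0X 2 ldT2)
    (has_logderiv0X 2 (has_logderiv0_prod ldg))))))).
rewrite sumrN sumrB -mulr_sumr big_const_seq count_predT iter_addr_0 szG.
rewrite /nb_vertices -/N /nD card_darts -muln2 natrM.
have -> : 4 *+ N.-1 = 4 * (N%:R - 1) :> R.
  by rewrite -subn1 -(natrB _ N0) mulr_natr.
by clear -N0; lra.
Qed.

End OneStep.

Theorem theorem3p1 (R : rcfType) (G : sgraph) (n : nat)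
  (Gconn : connected_graph G) (E0_ge1 : (1 <= nb_edges G)%N)
  (n_ge1 : (1 <= n)%N) :
  let N0 : R := (nb_vertices G)%:R in
  let E0 : R := (nb_edges G)%:R in
  kemeny R (hexagonal_iter n G) =
    5 * kemeny R (hexagonal_iter n.-1 G) - 4 / 3 * N0
    + (104 / 15 * 6 ^+ n.-1 + 16 / 15) * E0 - 2
  /\
  kemeny R (hexagonal_iter n G) =
    5 ^+ n * kemeny R G - 1 / 3 * (5 ^+ n - 1) * N0
    + 104 / 3 * ((6 / 5) ^+ n - 1) * 5 ^+ n.-1 * E0
    + 4 / 15 * (5 ^+ n - 1) * E0 - 1 / 2 * (5 ^+ n - 1).
Proof.
move=> N0 E0.
(* The last equation is N_k = N0 + 4 (6^k - 1) / 5 E0 without subtraction or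
   division. *)
have iterE k : [/\ connected_graph (hexagonal_iter k G),
    nb_edges (hexagonal_iter k G) = (6 ^ k * nb_edges G)%N &
    (5 * nb_vertices (hexagonal_iter k G) + 4 * nb_edges G =
     5 * nb_vertices G + 4 * 6 ^ k * nb_edges G)%N].
  elim: k => [|k [conn Ek Nk]]; first by split => //=; rewrite ?expn0; lia.
  rewrite /hexagonal_iter iterS -/(hexagonal_iter k G); split.
  - exact: connected_hex.
  - by rewrite nb_edges_hex Ek expnS mulnA.
  - by rewrite nb_vertices_hex mulnDr; move: Nk; rewrite Ek expnS; nia.
have step k : kemeny R (hexagonal_iter k.+1 G) =
    5 * kemeny R (hexagonal_iter k G) - 4 / 3 * N0
    + (104 / 15 * 6 ^+ k + 16 / 15) * E0 - 2.
  have [conn Ek Nk] := iterE k.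
  rewrite /hexagonal_iter iterS -/(hexagonal_iter k G) kemeny_hex //; last first.
    by rewrite Ek muln_gt0 expn_gt0.
  have /(congr1 (fun m => m%:R : R)) := Nk.
  rewrite Ek !(natrD, natrM, natrX) -/N0 -/E0.
  set K := kemeny _ _; set M := (nb_vertices _)%:R; set s := 6 ^+ k => Nk'.
  have -> : M = N0 + 4 / 5 * (s - 1) * E0 by lra.
  by field.
case: n n_ge1 => // n _; split; first exact: step.
elim: n => [|n IH].
  by rewrite step /= !expr1 expr0; field.
rewrite step IH !exprMn !exprVn /=.
rewrite !exprS.
have : 5 ^+ n != 0 :> R by rewrite expf_neq0 ?pnatr_eq0.
move: (5 ^+ n) (6 ^+ n) => u v u0; by field.
Qed.
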